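(* Let $\lambda/\mu$ be an r-shape and $\mathbf a,\mathbf b$ column flags for it. Then $$\mathsf S^{\mathbf a,\mathbf b}_{\lambda/\mu}(\mathbf y/\mathbf z)=\sum_{T\in ST_{\lambda/\mu}(\mathbf a,\mathbf b)}wt(T).$$
   Context: Young diagrams are in English notation; cell $(i,j)$ is in row $i$, column $j$; $\lambda'$ is the conjugate partition; $\lambda/\mu=[\lambda]\setminus[\mu]$ for $\mu\subseteq\lambda$. An r-shape is a pair $(\lambda/\mu,r)$, $r\in\mathbb Z$, with shifted contents $c(i,j)=j-i+r-1+\lambda'_1$ (bottom-left cell has content $r$). Column flags: for $n\ge\lambda_1$, $\mathbf a,\mathbf b\in\mathbb Z^n$ with $a_i-a_{i+1}\le\mu'_i-\mu'_{i+1}+1$ and $b_i-b_{i+1}\le\lambda'_i-\lambda'_{i+1}+1$ whenever $\mu'_i<\lambda'_{i+1}$; conjugate flags $a'_i=a_i+c(\gamma_i)$, $b'_i=b_i+c(\delta_i)$ with $\gamma_i,\delta_i$ the top and bottom cells of column $i$. $\mathbf y=(y_i)_{i\in\mathbb Z}$, $\mathbf z=(z_i)_{i\in\mathbb Z}$, $\mathbf y_{a,b}=(y_a,\dots,y_b)$ (empty if $a>b$); $e_n(\mathbf x/\mathbf w)=\sum_{i=0}^n(-1)^{n-i}e_i(\mathbf x)h_{n-i}(\mathbf w)$ ($e_0=1$, $e_n=0$ for $n<0$). $\mathsf S^{\mathbf a,\mathbf b}_{\lambda/\mu}(\mathbf y/\mathbf z)=\det[e_{\lambda'_i-i-\mu'_j+j}(\mathbf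 y_{a_j,b_i}/\mathbf z_{a'_j,b'_i})]_{1\le i,j\le n}$. A flagged $\mathbb Z$-SSYT of r-shape $\lambda/\mu$ with flags $\mathbf a,\mathbf b$ is a filling $\tilde T=(\tilde T_{ij})$ of the cells by integers, weakly increasing left to right along rows, strictly increasing top to bottom along columns, with $a_j\le\tilde T_{ij}\le b_j$ for every cell in column $j$. From such $\tilde T$, a flagged super tableau $T$ is obtained by choosing, independently for each cell, either $T_{ij}=\tilde T_{ij}\in\mathbb Z$ or the primed entry $T_{ij}=(\tilde T_{ij}+c(i,j))'\in\mathbb Z'$ ($c$ the shifted content). $ST_{\lambda/\mu}(\mathbf a,\mathbf b)$ is the set of all super tableaux so obtained from all flagged $\mathbb Z$-SSYT. The weight is $wt(T)=\prod_{(i,j)}wt(T_{ij})$ with $wt(r)=y_r$ and $wt(r')=-z_r$ for $r\in\mathbb Z$. *)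

(* Defs.v *)
From HB Require Import structures.
From mathcomp Require Import all_boot all_order all_algebra.
From mathcomp Require Import classical_sets fsbigop.
Set Implicit Arguments. Unset Strict Implicit. Unset Printing Implicit Defensive.
Import Order.TTheory GRing.Theory Num.Theory.
Local Open Scope ring_scope.

Definition is_partition (l : seq nat) : Prop := sorted geq l.
Definition part (l : seq nat) (i : nat) : nat := nth 0%N l i.-1.
Definition conj (l : seq nat) (j : nat) : nat := count (fun p => (j <= p)%N) l.
Definition subpart (mu l : seq nat) : Prop := forall i, (part mu i <= part l i)%N.

Definition in_skew (l mu : seq nat) (i j : nat) : bool :=
  [&& (0 < i)%N, (part mu i < j)%N & (j <= part l i)%N].

Definition content (l : seq nat) (r : int) (i j : nat) : int :=
  j%:Z - i%:Z + r - 1 + (conj l 1)%:Z.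

Definition column_flags (l mu : seq nat) (n : nat) (a b : nat -> int) : Prop :=
  (part l 1 <= n)%N /\
  forall i, (1 <= i)%N -> (i < n)%N -> (conj mu i < conj l i.+1)%N ->
    a i - a i.+1 <= (conj mu i)%:Z - (conj mu i.+1)%:Z + 1 /\
    b i - b i.+1 <= (conj l i)%:Z - (conj l i.+1)%:Z + 1.

(* top cell gamma_i = (mu'_i + 1, i), bottom cell delta_i = (lambda'_i, i) *)
Definition conj_flag_a (l mu : seq nat) (r : int) (a : nat -> int) (i : nat) : int :=
  a i + content l r (conj mu i).+1 i.
Definition conj_flag_b (l : seq nat) (r : int) (b : nat -> int) (i : nat) : int :=
  b i + content l r (conj l i) i.

Definition zrange (a b : int) : seq int :=
  if a <= b then [seq a + k%:Z | k <- iota 0 (absz (b - a)).+1] else [::].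

Definition elem {R : comNzRingType} (k : nat) (s : seq R) : R :=
  \sum_(I : {set 'I_(size s)} | #|I| == k) \prod_(i in I) s`_i.
Definition complete {R : comNzRingType} (k : nat) (s : seq R) : R :=
  \sum_(f : {ffun 'I_(size s) -> 'I_k.+1} | (\sum_(i < size s) (f i : nat))%N == k)
     \prod_(i < size s) s`_i ^+ f i.

Definition esuper {R : comNzRingType} (m : int) (x w : seq R) : R :=
  match m with
  | Posz m => \sum_(k < m.+1) (-1) ^+ (m - k) * elem k x * complete (m - k) w
  | Negz _ => 0
  end.

Definition yseg {R : Type} (y : int -> R) (a b : int) : seq R := [seq y i | i <- zrange a b].

Definition flagged_S {R : comNzRingType} (l mu : seq nat) (r : int) (n : nat)
    (a b : nat -> int) (y z : int -> R) : R :=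
  \det (\matrix_(i < n, j < n)
     esuper ((conj l i.+1)%:Z - (i.+1)%:Z - (conj mu j.+1)%:Z + (j.+1)%:Z)
            (yseg y (a j.+1) (b i.+1))
            (yseg z (conj_flag_a l mu r a j.+1) (conj_flag_b l r b i.+1))).

(** * Super tableaux.
    A filling lives on the box of rows 1..size l and columns 1..n; the cell
    (p, q) : 'I_L * 'I_n stands for (i, j) = (p+1, q+1).  An entry (v, false)
    is the unprimed integer v in Z, an entry (v, true) is the primed v' in Z'.
    Cells outside lambda/mu carry the dummy value (0, false). *)
Definition sfilling (L n : nat) := {ffun 'I_L * 'I_n -> int * bool}.

Definition cin (l mu : seq nat) (L n : nat) (c : 'I_L * 'I_n) : bool :=
  in_skew l mu (c.1).+1 (c.2).+1.

Definition untilde (l : seq nat) (r : int) (L n : nat) (T : sfilling L n)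
    (c : 'I_L * 'I_n) : int :=
  if (T c).2 then (T c).1 - content l r (c.1).+1 (c.2).+1 else (T c).1.

Definition flagged_ZSSYT (l mu : seq nat) (L n : nat) (a b : nat -> int)
    (U : 'I_L * 'I_n -> int) : Prop :=
  (forall c c' : 'I_L * 'I_n, cin l mu c -> cin l mu c' ->
      c.1 = c'.1 -> (c.2 < c'.2)%N -> U c <= U c') /\
  (forall c c' : 'I_L * 'I_n, cin l mu c -> cin l mu c' ->
      c.2 = c'.2 -> (c.1 < c'.1)%N -> U c < U c') /\
  (forall c : 'I_L * 'I_n, cin l mu c -> a (c.2).+1 <= U c <= b (c.2).+1).

Definition super_tableaux (l mu : seq nat) (r : int) (n : nat) (a b : nat -> int)
    : set (sfilling (size l) n) :=
  [set T : sfilling (size l) n | (forall c, ~~ cin l mu c -> T c = (0, false)) /\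
           flagged_ZSSYT l mu a b (untilde l r T)].

Arguments super_tableaux : clear implicits.

Definition wt {R : comNzRingType} (l mu : seq nat) (L n : nat) (y z : int -> R)
    (T : sfilling L n) : R :=
  \prod_(c | cin l mu c) (if (T c).2 then - z (T c).1 else y (T c).1).

(* Main.v *)
Require Import Defs.
From mathcomp Require Import all_boot all_order all_fingroup all_algebra.
From mathcomp Require Import classical_sets fsbigop.
From mathcomp Require Import zify ring.
Set Implicit Arguments. Unset Strict Implicit. Unset Printing Implicit Defensive.
Import Order.TTheory GRing.Theory Num.Theory.
Local Open Scope ring_scope.

(** The (i, j) entry of the determinant is a supersymmetric elementary function
    with N variables y and N + 1 - m variables z, i.e. it counts weighted lattice
    paths from a point P_j (given by a_j and mu'_j) to a point Q_i (given by b_i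
    and lambda'_i).  Splitting off the last step of the path to Q_i yields a
    two-term recursion for the entry, hence by multilinearity for the determinant:
    either lower b_i by one, or also delete the bottom cell of column i, at the
    cost of a factor y - z.  The tableaux obey the same recursion according to
    whether or not the bottom entry of column i equals b_i.  For the deletion to
    be compatible with the neighbouring columns and for the flag conditions to
    survive, i is taken to be the last nonempty column whose endpoint lies
    strictly to the right of the endpoint of the previous column (or which shares
    no row with it).  If the next column has the same length, both recursions lose
    their second term: the determinant has two equal rows. *)

(** * Generating functions for supersymmetric elementary functions *)

Section SupersymmetricElementary.
Variable R : comNzRingType.
Implicit Types (s x w : seq R) (c : R).

Definition elem_gf s : {poly R} := \prod_(c <- s) (c *: 'X + 1).

(* A truncation of 1 / (1 + c X). *)
Definition geom D c : {poly R} := \poly_(k < D.+1) (- c) ^+ k.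

(** Up to degree [D], the coefficients are the signed complete functions [(-1)^k h_k]. Truncation
    keeps the computation among polynomials instead of power series. *)
Definition complete_gf D s : {poly R} := \prod_(c <- s) geom D c.

Lemma elemE k s : elem k s = (elem_gf s)`_k.
Proof.
rewrite /elem_gf (big_nth 0) big_mkord bigA_distr coef_sum /elem.
under [RHS]eq_bigr => I _ do rewrite -big_mkcond /= scaler_prod prodr_const coefZ coefXn.
rewrite [LHS]big_mkcond; apply: eq_bigr => I _.
by rewrite eq_sym; case: eqP => _; rewrite ?mulr1 ?mulr0.
Qed.

(** Coefficient [k] of a product sees only terms of degree at most [k] of the factors, so any [D] at
    least [k] serves. *)
Lemma coef_prod_geom D k s : (k <= D)%N ->
  (complete_gf D s)`_k = (complete_gf k s)`_k.
Proof.
rewrite /complete_gf => leD.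
suff: forall j, (j <= k)%N -> (\prod_(c <- s) geom D c)`_j = (\prod_(c <- s) geom k c)`_j.
  by apply.
elim: s => [|c s IHs] j lejk; first by rewrite !big_nil.
rewrite !big_cons !coefM; apply: eq_bigr => -[i /= ltij] _.
have leik : (i <= k)%N by lia.
by rewrite IHs ?coef_poly ?ltnS ?leik ?(leq_trans leik) //; lia.
Qed.

Lemma completeE D k s : (k <= D)%N -> (-1) ^+ k * complete k s = (complete_gf D s)`_k.
Proof.
(* Lowering [D] to [k] makes the exponents range over ['I_k.+1], the codomain used in [complete]. *)
move=> /coef_prod_geom ->; rewrite /complete_gf (big_nth 0) big_mkord.
rewrite (eq_bigr (fun i : 'I_(size s) => \sum_(j < k.+1) (- s`_i) ^+ j *: 'X^j)); last first.
  by move=> i _; rewrite /geom poly_def.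
rewrite bigA_distr_bigA coef_sum /complete big_mkcond big_distrr.
apply: eq_bigr => f _ /=.
rewrite scaler_prod -(big_morph _ (exprD 'X) (expr0 'X)) coefZ coefXn eq_sym.
case: eqP => [ek|_]; rewrite ?mulr0 // mulr1 {1}ek.
under [RHS]eq_bigr => i _ do rewrite -mulN1r exprMn.
by rewrite big_split /= -(big_morph _ (exprD (-1)) (expr0 (-1))).
Qed.

Lemma esuperE D m x w : (m <= D)%N ->
  esuper m%:Z x w = (elem_gf x * complete_gf D w)`_m.
Proof.
move=> lemD; rewrite /= coefM; apply: eq_bigr => -[i /= lti] _.
by rewrite -elemE -completeE ?(leq_trans (leq_subr _ _)) // mulrA [_ * elem _ _]mulrC.
Qed.

Lemma elem_gf_rcons x c : elem_gf (rcons x c) = elem_gf x * (c *: 'X + 1).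
Proof. by rewrite /elem_gf -cats1 big_cat big_seq1. Qed.

Lemma geomM D c : geom D c * (c *: 'X + 1) = 1 - (- c) ^+ D.+1 *: 'X^(D.+1).
Proof.
rewrite /geom poly_def mulrC.
have -> : c *: 'X + 1 = 1 - (- c) *: 'X :> {poly R} by rewrite scaleNr opprK addrC.
under eq_bigr => i _ do rewrite -exprZn.
rewrite -exprZn -[1 - (_ *: 'X) ^+ _]opprB -[1 - _ *: 'X]opprB subrX1 mulNr.
by [].
Qed.

Lemma esuper_rcons_elem (m : nat) x c w :
  esuper m.+1%:Z (rcons x c) w = esuper m.+1%:Z x w + c * esuper m%:Z x w.
Proof.
rewrite !(@esuperE m.+1) // elem_gf_rcons mulrAC mulrDr mulr1 coefD addrC.
by rewrite -scalerAr coefZ coefMX.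
Qed.

Lemma esuper_rcons_complete (m : nat) x c w :
  esuper m.+1%:Z x w =
  esuper m.+1%:Z x (rcons w c) + c * esuper m%:Z x (rcons w c).
Proof.
rewrite !(@esuperE m.+1) //.
(* By [geomM], multiplying by [c X + 1] cancels the factor of [c] up to an error of degree [m + 2],
   invisible in coefficient [m + 1]. *)
have -> : elem_gf x * complete_gf m.+1 w = 
  elem_gf x * complete_gf m.+1 (rcons w c) * (c *: 'X + 1)
  + (- c) ^+ m.+2 *: (elem_gf x * complete_gf m.+1 w * 'X^(m.+2)).
  rewrite {2}/complete_gf -cats1 big_cat big_seq1 /= -/(complete_gf _ _).
  by rewrite -!mulrA geomM !mulrBr !mulr1 -!scalerAr subrK.
rewrite coefD mulrDr mulr1 coefD -scalerAr coefZ coefMX /=.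
by rewrite coefZ coefMXn ltnSn mulr0 addr0 addrC.
Qed.

Lemma esuper0 x w : esuper 0 x w = 1.
Proof.
rewrite (@esuperE 0) // coefM big_ord_recl big_ord0 addr0 /= subn0 -!horner_coef0.
rewrite !horner_prod !big1 ?mulr1 // => c _.
  by rewrite horner_coef0 coef_poly.
by rewrite hornerD hornerZ hornerX hornerC mulr0 add0r.
Qed.

Lemma esuper_nil_complete (m : nat) x : (size x < m)%N -> esuper m%:Z x [::] = 0.
Proof.
move=> ltm; rewrite (@esuperE m) // /complete_gf big_nil mulr1 -elemE /elem.
rewrite big1 // => I /eqP Im; move: (max_card (mem I)).
by rewrite Im card_ord leqNgt ltm.
Qed.

Lemma esuper_lt0 (m : int) x w : m < 0 -> esuper m x w = 0.
Proof. by case: m. Qed.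
End SupersymmetricElementary.

(** * Integer intervals and the entries of the determinant *)

Lemma zrange_nil (a b : int) : b < a -> zrange a b = [::].
Proof. by rewrite /zrange leNgt => ->. Qed.

Lemma zrange_rcons (a b : int) : a <= b -> zrange a b = rcons (zrange a (b - 1)) b.
Proof.
move=> leab; have [[|m] ->] : exists m : nat, b = a + m%:Z by exists `|b - a|%N; lia.
  by rewrite /zrange addr0 lexx subrr (_ : (a <= a - 1) = false) /= ?addr0 //; lia.
have -> : a + m.+1%:Z - 1 = a + m%:Z by lia.
rewrite /zrange !ifT; [|lia..].
have -> : absz (a + m.+1%:Z - a)%R = m.+1 by lia.
have -> : absz (a + m%:Z - a)%R = m by lia.
by rewrite -[m.+2]addn1 (iotaD 0 m.+1 1) map_cat cats1.
Qed.

Lemma size_zrange (a b : int) : a <= b + 1 -> (size (zrange a b))%:Z = b - a + 1.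
Proof. by rewrite /zrange => ?; case: lerP => ?; rewrite ?size_map ?size_iota /=; lia. Qed.

Section Entry.
Context {R : comNzRingType}.
Variables (y z : int -> R) (K : int).
Implicit Types al p be q : int.

(** The path runs from [(al, p)] to [(be, q)], where [p] and [q] stand for [mu'_j - j] and
    [lambda'_i - i]. The constant [K] is the part of the content that does not depend on the
    cell. *)
Definition entry al p be q : R :=
  esuper (q - p) (yseg y al be) (yseg z (al - p + K) (be - q + 1 + K)).

Lemma entry_below al p be q : q < p -> entry al p be q = 0.
Proof. by move=> ?; rewrite /entry esuper_lt0 //; lia. Qed.

Lemma entry_level al p be : entry al p be p = 1.
Proof. by rewrite /entry subrr esuper0. Qed.

(** No z variable remains, and the entry is an ordinary elementary function of degree greater than
    its number of variables. *)
Lemma entry_infeasible al p be q : p < q -> be + 1 - q < al - p -> entry al p be q = 0.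
Proof.
move=> ltpq infeasible; rewrite /entry /yseg (@zrange_nil (_ + K)); last lia.
have -> : q - p = `|q - p|%N%:Z by lia.
rewrite esuper_nil_complete // size_map.
case: (lerP al (be + 1)) => [leab|ltba]; last by rewrite zrange_nil //=; lia.
by have := size_zrange leab; lia.
Qed.

(** An infeasible entry makes all three terms vanish, except when [q = p + 1]: the last entry is
    then level and equals 1. Only this case needs the hypothesis. *)
Lemma entry_rec al p be q : (q = p + 1 -> al - p <= be + 1 - q) ->
  entry al p be q =
  entry al p (be - 1) q + (y be - z (be - q + 1 + K)) * entry al p (be - 1) (q - 1).
Proof.
move=> feas1; case: (ltrgtP q p) => [ltqp|ltpq|->].
- by rewrite !entry_below ?mulr0 ?addr0 //; lia.
- case: (lerP (al - p) (be + 1 - q)) => [feasible|infeasible]; last first.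
    by rewrite !entry_infeasible ?mulr0 ?addr0 //; lia.
  rewrite /entry /yseg.
  have -> : q - 1 - p = (`|q - p|.-1)%N%:Z by lia.
  have -> : q - p = (`|q - p|.-1).+1%:Z by lia.
  have -> : be - 1 - (q - 1) + 1 + K = be - q + 1 + K by lia.
  have -> : be - 1 - q + 1 + K = be - q + 1 + K - 1 by lia.
  have -> := @zrange_rcons al be; last lia.
  have -> := @zrange_rcons (al - p + K) (be - q + 1 + K); last lia.
  rewrite !map_rcons esuper_rcons_elem.
  set ws := map z _.
  (* The first term on the right has lost the last z variable. Restoring it brings all terms to the
     same variables. *)
  rewrite [X in _ = X + _](esuper_rcons_complete _ _ (z (be - q + 1 + K))).
  by ring.
- by rewrite !entry_level entry_below ?mulr0 ?addr0 //; lia.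
Qed.
End Entry.

(** * Pigeonhole facts on permutations *)

Section Perm.
Context {n : nat}.
Implicit Types (s : 'S_n) (i k : 'I_n).

(** Otherwise [s] would permute the indices above [p] among themselves, leaving none of them as the
    image of [i]. *)
Lemma perm_crossing s (p : nat) i : (i <= p < s i)%N ->
  exists2 i' : 'I_n, (p < i')%N & (s i' <= p)%N.
Proof.
move=> /andP[leip ltpsi].
suff /existsP[i' /andP[? ?]] : [exists i' : 'I_n, (p < i')%N && (s i' <= p)%N] by exists i'.
apply: contraT; rewrite negb_exists => /forallP no.
have sub : s @: [set i' : 'I_n | (p < i')%N] \subset [set i' : 'I_n | (p < i')%N].
  apply/fintype.subsetP => _ /imsetP[i' i'p ->]; move: i'p (no i').
  by rewrite !inE => ->; rewrite -ltnNge.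
have /setP/(_ (s i)) : s @: [set i' : 'I_n | (p < i')%N] = [set i' : 'I_n | (p < i')%N].
  by apply/eqP; rewrite eqEcard sub (card_imset _ (@perm_inj _ s)) leqnn.
by rewrite (mem_imset _ _ (@perm_inj _ s)) !inE ltpsi ltnNge leip.
Qed.

(** The indices up to [k] cannot all be sent below [k], as there are too few places. *)
Lemma perm_weak_excedance s k : exists2 i : 'I_n, (i <= k)%N & (k <= s i)%N.
Proof.
suff /existsP[i /andP[? ?]] : [exists i : 'I_n, (i <= k)%N && (k <= s i)%N] by exists i.
apply: contraT; rewrite negb_exists => /forallP no.
have sub : s @: [set i : 'I_n | (i <= k)%N] \proper [set i : 'I_n | (i <= k)%N].
  rewrite properE; apply/andP; split; apply/fintype.subsetP.
    move=> _ /imsetP[i ik ->]; move: ik (no i).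
    by rewrite !inE => ->; rewrite -ltnNge => /ltnW.
  move=> /(_ k); rewrite inE leqnn => /(_ isT)/imsetP[i ik eqk].
  by move: ik (no i); rewrite inE -eqk => ->; rewrite leqnn.
by have := proper_card sub; rewrite (card_imset _ (@perm_inj _ s)) ltnn.
Qed.
End Perm.

(** * Skew shapes by columns, and the choice of a corner *)

Definition skew_columns (n : nat) (lc mc : nat -> nat) : Prop :=
  [/\ forall i j, (i <= j < n)%N -> (lc j <= lc i)%N,
      forall i j, (i <= j < n)%N -> (mc j <= mc i)%N &
      forall j, (j < n)%N -> (mc j <= lc j)%N].

(* The coordinate of a path endpoint that is weakly increasing from column to
   column; the other one, h i - i, is strictly decreasing. *)
Definition lag (f : nat -> int) (h : nat -> nat) (i : nat) : int := f i - (h i)%:Z + i%:Z.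

(** The column flag inequalities restated through [lag]. The premise [mc i < lc i.+1] says that
    columns [i] and [i + 1] share a row. *)
Definition flags_ok (n : nat) (lc mc : nat -> nat) (a b : nat -> int) : Prop :=
  forall i, (i.+1 < n)%N -> (mc i < lc i.+1)%N ->
    lag a mc i <= lag a mc i.+1 /\ lag b lc i <= lag b lc i.+1.

Definition dec_at (i : nat) (f : nat -> nat) : nat -> nat :=
  fun k => if k == i then (f k).-1 else f k.

Definition dec_flag (i : nat) (f : nat -> int) : nat -> int :=
  fun k => if k == i then f k - 1 else f k.

Section Coupling.
Context {n : nat} {lc mc : nat -> nat} {a b : nat -> int}.
Hypotheses (shape : skew_columns n lc mc) (flags : flags_ok n lc mc a b).

Lemma lag_homo (i j : nat) : (i <= j < n)%N ->
  (forall p, (i <= p < j)%N -> (mc p < lc p.+1)%N) ->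
  lag a mc i <= lag a mc j /\ lag b lc i <= lag b lc j.
Proof.
elim: j => [|j IHj] /andP[leij ltjn] coupled.
  by have -> : i = 0%N by lia.
case: (leqP i j) => [leij'|?]; last by have -> : i = j.+1 by lia.
have [|p pij|? ?] := IHj; [lia | by apply: coupled; lia |].
have [||? ?] := @flags j; [lia | by apply: coupled; lia |].
by split; [apply: le_trans (_ : lag a mc j <= _) | apply: le_trans (_ : lag b lc j <= _)].
Qed.

(** The first property lets [b i] drop without breaking the flag condition to the left. The second
    handles a next column of equal length: it yields the equal rows and keeps the bottom entry below
    [b i]. *)
Lemma exists_corner : (exists2 k, (k < n)%N & (mc k < lc k)%N) ->
  exists2 i : 'I_n, (mc i < lc i)%N &
    [/\ forall p, p.+1 = i -> (mc p < lc i)%N -> lag b lc p < lag b lc i &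
        (i.+1 < n)%N -> (mc i < lc i.+1)%N -> lag b lc i.+1 = lag b lc i].
Proof.
case: shape => lcD mcD lemc exk.
pose good (i : 'I_n) := (mc i < lc i)%N &&
  [|| i == 0%N :> nat, (lc i <= mc i.-1)%N | lag b lc i.-1 < lag b lc i].
have [i0 good0] : exists i, good i.
  (* The first nonempty column is good: if it has a predecessor, that one is empty and so shares no
     row with it. *)
  have /ex_minnP[m /andP[ltmn ltm] minm] : exists k, (k < n)%N && (mc k < lc k)%N.
    by case: exk => k ltkn ltk; exists k; rewrite ltkn.
  exists (Ordinal ltmn); rewrite /good /= ltm /=.
  case: (posnP m) => //= m_gt0; apply/orP; left.
  have := minm m.-1; have := lcD m.-1 m; lia.
case: (@arg_maxnP _ i0 good (fun i => i) good0) => i /andP[lti goodi] maxi.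
exists i => //; split.
  by move=> p ip; move: goodi; rewrite -ip /=; case/orP=> //; lia.
move=> lti1 coupled; have [//|//|_ leb] := @flags i.
apply/le_anti/andP; split=> //; rewrite leNgt; apply/negP => ltb.
(* A strict rise would make column [i + 1] good, against the maximality of [i]. *)
have /maxi /= : good (Ordinal lti1); last by lia.
by rewrite /good /= ltb !orbT andbT; have := mcD i i.+1; lia.
Qed.
End Coupling.

(** * Vanishing and recursion of the determinant *)

Section Determinant.
Context {R : comNzRingType}.
Variables (y z : int -> R) (K : int) (n : nat).

Definition jt_matrix (lc mc : nat -> nat) (a b : nat -> int) : 'M[R]_n :=
  \matrix_(i, j) entry y z K (a j) ((mc j)%:Z - j%:Z) (b i) ((lc i)%:Z - i%:Z).

Variables (lc mc : nat -> nat) (a b : nat -> int).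
Hypotheses (shape : skew_columns n lc mc) (flags : flags_ok n lc mc a b).

Lemma det_jt_empty : (forall k, (k < n)%N -> lc k = mc k) ->
  \det (jt_matrix lc mc a b) = 1.
Proof.
case: shape => lcD mcD lemc empty; rewrite -det_tr det_trig.
  by apply: big1 => i _; rewrite !mxE empty // entry_level.
apply/is_trig_mxP => i j ltij; rewrite !mxE entry_below //.
by rewrite !empty //; have := mcD i j; have := ltn_ord j; lia.
Qed.

(** Every term of the Leibniz expansion has a zero factor. Take [i] with [i <= k <= s i]. If
    consecutive columns from [i] to [s i] all share rows, monotonicity of [lag] makes the entry at
    [(i, s i)] infeasible. Otherwise [s] crosses a gap, and the index crossing back gives an entry
    whose end lies below its start. *)
Lemma det_jt_infeasible (k : 'I_n) : (mc k < lc k)%N -> lag b lc k + 1 < lag a mc k ->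
  \det (jt_matrix lc mc a b) = 0.
Proof.
case: shape => lcD mcD lemc ltk infeasible; rewrite /determinant big1 // => s _.
suff [i Mi0] : exists i, jt_matrix lc mc a b i (s i) = 0.
  by rewrite (bigD1 i) //= Mi0 mul0r mulr0.
have [i leik leks] := perm_weak_excedance s k.
have ltsn := ltn_ord (s i).
case: (boolP [exists p : 'I_n, (i <= p < s i)%N && (lc p.+1 <= mc p)%N]).
  case/existsP=> p /andP[ip uncoupled].
  have [i' ltpi' lesp] := perm_crossing ip.
  exists i'; rewrite mxE entry_below //.
  by have := lcD p.+1 i'; have := mcD (s i') p; have := ltn_ord i'; lia.
rewrite negb_exists => /forallP coupled.
have {}coupled p : (i <= p < s i)%N -> (mc p < lc p.+1)%N.
  move=> ip; have ltpn : (p < n)%N by lia.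
  by have := coupled (Ordinal ltpn); rewrite /= ip /= ltnNge.
have [||_ leQ] := lag_homo flags (i := i) (j := k); [lia | by move=> p ?; apply: coupled; lia |].
have [||leP _] := lag_homo flags (i := k) (j := s i); [lia | by move=> p ?; apply: coupled; lia |].
exists i; rewrite mxE entry_infeasible //.
  by have := lcD i k; have := mcD k (s i); lia.
by rewrite /lag in infeasible leQ leP; lia.
Qed.

Lemma det_jt_rec (i : 'I_n) : (mc i < lc i)%N -> lag a mc i <= lag b lc i + 1 ->
  \det (jt_matrix lc mc a b) =
  \det (jt_matrix lc mc a (dec_flag i b)) +
  (y (b i) - z (b i - ((lc i)%:Z - i%:Z) + 1 + K)) *
    \det (jt_matrix (dec_at i lc) mc a (dec_flag i b)).
Proof.
case: shape => lcD mcD lemc lti feasible.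
have lift_neq k : lift i k != i :> nat by rewrite eq_sym; apply: neq_lift.
set w := _ - z _; rewrite -[X in _ = X + _]mul1r.
apply: (@determinant_multilinear _ _ _ _ _ i).
- apply/rowP => j; rewrite !mxE /dec_at /dec_flag eqxx mul1r.
  have -> : ((lc i).-1)%:Z - i%:Z = (lc i)%:Z - i%:Z - 1 by lia.
  (* When the degree is 1, column [j] is at or left of [i] and all neighbours in between share rows,
     so the feasibility of column [i] passes to the start point of column [j]. *)
  apply: entry_rec => eqq.
  have leji : (j <= i)%N by have := mcD i j; have := ltn_ord j; lia.
  suff [] : lag a mc j <= lag a mc i /\ lag b lc j <= lag b lc i.
    by rewrite /lag in feasible *; lia.
  apply: (lag_homo flags); first by have := ltn_ord i; lia.
  move=> p /andP[lejp ltpi].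
  by have := mcD j p; have := lcD p.+1 i; have := ltn_ord i; lia.
- apply/matrixP => k j; rewrite !mxE /dec_flag.
  by rewrite (negbTE (lift_neq k)).
- apply/matrixP => k j; rewrite !mxE /dec_flag /dec_at.
  by rewrite !(negbTE (lift_neq k)).
Qed.

(** Deleting the cell and lowering the flag moves the endpoint of column [i] onto that of column
    [i + 1]. *)
Lemma det_jt_row_eq (i : 'I_n) : (mc i < lc i)%N -> (i.+1 < n)%N -> lc i.+1 = lc i ->
  lag b lc i.+1 = lag b lc i ->
  \det (jt_matrix (dec_at i lc) mc a (dec_flag i b)) = 0.
Proof.
move=> lti lti1 eqlc eqlag.
apply: (@determinant_alternate _ _ _ i (Ordinal lti1)).
  by rewrite -val_eqE /= ltn_eqF.
move=> j; rewrite !mxE /= /dec_at /dec_flag eqxx gtn_eqF // eqlc.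
by congr entry; rewrite /lag in eqlag; lia.
Qed.

Lemma dec_skew_columns (i : 'I_n) : (mc i < lc i)%N -> 
  ((i.+1 < n)%N -> (lc i.+1 < lc i)%N) -> skew_columns n (dec_at i lc) mc.
Proof.
case: shape => lcD mcD lemc lti corner; split=> // j; rewrite /dec_at.
  move=> k jk; have := lcD j k jk; move: jk.
  case: (j =P i :> nat) => [->|_]; case: (k =P i :> nat) => [->|nki] jk lejk; try lia.
  have lti1 : (i.+1 < n)%N by lia.
  by have := lcD i.+1 k; have := corner lti1; lia.
by move=> ltj; have := lemc j ltj; case: (j =P i :> nat) => [->|]; lia.
Qed.

Lemma dec_flag_ok (i : 'I_n) :
  (forall p, p.+1 = i -> (mc p < lc i)%N -> lag b lc p < lag b lc i) ->
  flags_ok n lc mc a (dec_flag i b).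
Proof.
move=> left j ltj coupled; have [//|//|? leb] := @flags j; split=> //.
rewrite /lag /dec_flag in left leb *.
case: (j.+1 =P i :> nat) => [ij|_]; last by case: eqP => _; lia.
by have := left j ij; rewrite -ij => /(_ coupled); rewrite ltn_eqF //; lia.
Qed.

(** Shortening the column and lowering its flag together leave [lag b lc] unchanged, while fewer
    columns share rows. *)
Lemma dec_flags_ok (i : 'I_n) : (0 < lc i)%N ->
  flags_ok n (dec_at i lc) mc a (dec_flag i b).
Proof.
move=> lc_gt0.
have lag_dec j : lag (dec_flag i b) (dec_at i lc) j = lag b lc j.
  by rewrite /lag /dec_flag /dec_at; case: (j =P i :> nat) => [->|]; lia.
move=> j ltj coupled; rewrite !lag_dec; apply: flags => //.
by move: coupled; rewrite /dec_at; case: eqP => _; lia.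
Qed.
End Determinant.

(** * Tableaux with a bottom cell removed or added *)

Section Tableaux.
Variables (L n : nat) (K : int) (mc : nat -> nat) (a : nat -> int).
Implicit Types (lc : nat -> nat) (b : nat -> int) (c : 'I_L * 'I_n) (T : sfilling L n).

Definition in_columns lc c : bool := (mc c.2 <= c.1 < lc c.2)%N.

Definition unprime c (x : int * bool) : int :=
  if x.2 then x.1 - (c.2%:Z - c.1%:Z + K) else x.1.

Definition is_tableau lc b T : Prop :=
  [/\ forall c, ~~ in_columns lc c -> T c = (0, false),
      forall c c', in_columns lc c -> in_columns lc c' ->
        c.1 = c'.1 -> (c.2 < c'.2)%N -> unprime c (T c) <= unprime c' (T c'),
      forall c c', in_columns lc c -> in_columns lc c' ->
        c.2 = c'.2 -> (c.1 < c'.1)%N -> unprime c (T c) < unprime c' (T c') &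
      forall c, in_columns lc c -> a c.2 <= unprime c (T c) <= b c.2].

Definition upd (c0 : 'I_L * 'I_n) (x : int * bool) T : sfilling L n :=
  [ffun c => if c == c0 then x else T c].

Lemma column_growth lc b T : is_tableau lc b T -> forall (k : nat) c c',
  in_columns lc c -> in_columns lc c' -> c.2 = c'.2 -> (c'.1 : nat) = (c.1 + k)%N ->
  unprime c (T c) + k%:Z <= unprime c' (T c').
Proof.
case=> _ _ colT _; elim=> [|k IHk] c c' cin c'in eqcol eqrow.
  suff -> : c = c' by rewrite addr0.
  by case: c c' eqcol eqrow {cin c'in} => [? ?] [? ?] /= -> e; congr (_, _); apply: val_inj; rewrite /= e addn0.
have ltL : (c.1 + k < L)%N by have := ltn_ord c'.1; lia.
have midin : in_columns lc (Ordinal ltL, c.2).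
  by move: cin c'in; rewrite /in_columns /= eqcol eqrow; lia.
have := IHk c (Ordinal ltL, c.2) cin midin erefl erefl.
have := colT (Ordinal ltL, c.2) c' midin c'in eqcol; rewrite /= eqrow; lia.
Qed.

Section Corner.
Variables (lc : nat -> nat) (b : nat -> int) (c0 : 'I_L * 'I_n).
Local Notation i := c0.2.
Hypotheses (c0row : c0.1.+1 = lc i) (c0in : (mc i < lc i)%N).

Lemma in_columns_corner : in_columns lc c0.
Proof. by rewrite /in_columns; lia. Qed.

Lemma in_columns_dec c : in_columns (dec_at i lc) c = in_columns lc c && (c != c0).
Proof.
case: c => r j; rewrite /in_columns /dec_at -pair_eqE /pair_eq /= -!val_eqE /=.
by case: (j =P i :> nat) => [->|]; lia.
Qed.

(** The bottom entry is the largest of its column, so the whole column obeys the lowered flag. *)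
Lemma unprime_bottom_lt T : is_tableau lc b T -> unprime c0 (T c0) < b i ->
  is_tableau lc (dec_flag i b) T.
Proof.
move=> tabT ltb; have [outT rowT colT flagT] := tabT; split=> // c cin.
have := flagT c cin; rewrite /dec_flag; case: (c.2 =P i :> nat) => // eqc /andP[-> _] /=.
have le_row : (c.1 <= c0.1)%N by move: cin; rewrite /in_columns eqc; lia.
have eqc2 : c.2 = i by apply: val_inj.
have := column_growth tabT (k := c0.1 - c.1) cin in_columns_corner eqc2.
by rewrite eqc2; lia.
Qed.

Lemma is_tableau_dec_flag T : is_tableau lc (dec_flag i b) T ->
  is_tableau lc b T /\ unprime c0 (T c0) < b i.
Proof.
case=> outT rowT colT flagT; split.
  split=> // c cin; have := flagT c cin; rewrite /dec_flag; case: eqP => // ->; lia.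
have := flagT c0 in_columns_corner; rewrite /dec_flag eqxx; lia.
Qed.

Lemma remove_corner T : is_tableau lc b T -> unprime c0 (T c0) = b i ->
  is_tableau (dec_at i lc) (dec_flag i b) (upd c0 (0, false) T).
Proof.
case=> outT rowT colT flagT eqb; split.
- by move=> c; rewrite in_columns_dec ffunE; case: eqP => //= _; rewrite andbT => /outT.
- move=> c c'; rewrite !in_columns_dec !ffunE => /andP[cin /negbTE ->] /andP[c'in /negbTE ->].
  exact: rowT.
- move=> c c'; rewrite !in_columns_dec !ffunE => /andP[cin /negbTE ->] /andP[c'in /negbTE ->].
  exact: colT.
- move=> c; rewrite in_columns_dec ffunE => /andP[cin nc]; rewrite (negbTE nc).
  have := flagT c cin; rewrite /dec_flag; case: (c.2 =P i :> nat) => // eqc /andP[-> _] /=.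
  have eqc2 : c.2 = i by apply: val_inj.
  suff ltrow : (c.1 < c0.1)%N.
    by have := colT c c0 cin in_columns_corner eqc2 ltrow; rewrite eqc2; lia.
  rewrite ltn_neqAle; apply/andP; split.
    by apply: contraNneq nc => e; rewrite [c]surjective_pairing [c0]surjective_pairing eqc2 (val_inj e).
  by move: cin; rewrite /in_columns eqc; lia.
Qed.

Hypothesis shape : skew_columns n lc mc.

(** The right neighbour of the corner is at most [b (i + 1)], which equals [b i - 1] when the
    columns have equal length. *)
Lemma blocked_corner_lt T :
  ((i.+1 < n)%N -> (mc i < lc i.+1)%N -> lag b lc i.+1 = lag b lc i) ->
  (i.+1 < n)%N -> lc i.+1 = lc i -> is_tableau lc b T ->
  unprime c0 (T c0) < b i.
Proof.
case: shape => _ mcD _ right lti1 eqlc [_ rowT _ flagT].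
have c1in : in_columns lc (c0.1, Ordinal lti1).
  by rewrite /in_columns /= eqlc; have := mcD i i.+1; lia.
have := rowT c0 (c0.1, Ordinal lti1) in_columns_corner c1in erefl.
have := flagT _ c1in; have := right lti1; rewrite eqlc /lag /= ltnSn eqlc; lia.
Qed.

Hypothesis lcL : forall j, (j < n)%N -> (lc j <= L)%N.
Hypothesis left : forall p, p.+1 = i -> (mc p < lc i)%N -> lag b lc p < lag b lc i.

Lemma add_corner T x : ((i.+1 < n)%N -> (lc i.+1 < lc i)%N) ->
  lag a mc i <= lag b lc i + 1 ->
  is_tableau (dec_at i lc) (dec_flag i b) T -> unprime c0 x = b i ->
  is_tableau lc b (upd c0 x T).
Proof.
case: shape => lcD mcD _ corner feasible tabT eqx; have [outT rowT colT flagT] := tabT.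
have decin c : in_columns lc c -> c != c0 -> in_columns (dec_at i lc) c.
  by move=> cin nc; rewrite in_columns_dec cin.
have updN c : c != c0 -> upd c0 x T c = T c by move=> /negbTE nc; rewrite ffunE nc.
have updE : upd c0 x T c0 = x by rewrite ffunE eqxx.
have col_lt c : in_columns lc c -> c != c0 -> c.2 = i -> unprime c (T c) < b i.
  move=> cin nc eqc; have := flagT c (decin c cin nc).
  by rewrite /dec_flag eqc eqxx; lia.
split.
- move=> c cout; rewrite updN ?outT ?in_columns_dec ?(negbTE cout) //.
  by apply: contraNneq cout => ->; apply: in_columns_corner.
- move=> c c' cin c'in eqrow ltcol.
  (* The corner has no cell to its right, since the next column is strictly shorter. *)
  case: (eqVneq c c0) => [ec|nc].
    have {corner} := corner; have := ltn_ord c'.2; have := lcD i.+1 c'.2.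
    by move: c'in; rewrite -?ec /in_columns -eqrow {1}ec; rewrite ec in ltcol *; lia.
  case: (eqVneq c' c0) => [ec'|nc']; last by rewrite !updN //; apply: rowT; rewrite ?decin.
  rewrite ec' updE updN // eqx; rewrite {}ec' {c' c'in} in eqrow ltcol.
  (* Column [p = i - 1] continues below the corner's row down to an entry at most [b p], so its
     entry in that row is at most [b p - (lc p - lc i)]. The strict rise of [lag] bounds this by
     [b i]. *)
  have [p ip] : exists p, p.+1 = i :> nat by exists i.-1; lia.
  have ltpn : (p < n)%N by have := ltn_ord i; lia.
  have coupled : (mc p < lc i)%N.
    by move: cin; rewrite /in_columns eqrow; have := mcD c.2 p; lia.
  have lagp := left ip coupled.
  have lelc : (lc i <= lc p)%N by apply: lcD; have := ltn_ord i; lia.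
  have ltL : ((lc p).-1 < L)%N by have := lcL ltpn; lia.
  have cpin (r : 'I_L) : (c0.1 <= r < lc p)%N -> in_columns (dec_at i lc) (r, Ordinal ltpn).
    by move=> ?; rewrite /in_columns /dec_at /= ltn_eqF; lia.
  have topin := cpin c0.1 ltac:(lia).
  have botin := cpin (Ordinal ltL) ltac:(rewrite /=; lia).
  have := column_growth tabT (k := (lc p).-1 - c0.1) topin botin erefl ltac:(rewrite /=; lia).
  have := flagT _ botin.
  rewrite /dec_flag /= ltn_eqF; last lia.
  suff : unprime c (T c) <= unprime (c0.1, Ordinal ltpn) (T (c0.1, Ordinal ltpn)).
    by rewrite /lag in lagp; lia.
  case: (ltngtP c.2 p) => [ltcp|ltpc|eqcp]; first 2 last.
  - suff -> : c = (c0.1, Ordinal ltpn) by [].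
    by rewrite [c]surjective_pairing eqrow; congr (_, _); apply: val_inj.
  - by apply: rowT => //; apply: decin.
  - by lia.
- move=> c c' cin c'in eqcol ltrow.
  have nc : c != c0.
    apply: contraTneq c'in => ec; rewrite /in_columns -eqcol ec.
    by rewrite ec in ltrow; lia.
  case: (eqVneq c' c0) => [ec'|nc']; last by rewrite !updN //; apply: colT; rewrite ?decin.
  by rewrite ec' updE eqx updN //; apply: col_lt => //; rewrite eqcol ec'.
- move=> c cin; case: (eqVneq c c0) => [->|nc].
    by rewrite updE eqx lexx andbT; rewrite /lag in feasible; lia.
  by rewrite updN //; have := flagT c (decin c cin nc); rewrite /dec_flag; case: eqP => // ->; lia.
Qed.
End Corner.
End Tableaux.

(** * Enumeration of the tableaux and their weight sum *)

Section Enumeration.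
Context {R : comNzRingType}.
Variables (y z : int -> R) (L n : nat) (K : int) (mc : nat -> nat) (a : nat -> int).
Implicit Types (lc : nat -> nat) (b : nat -> int) (T : sfilling L n).

Definition letter_wt (x : int * bool) : R := if x.2 then - z x.1 else y x.1.

Definition tableau_wt lc T : R := \prod_(c | in_columns mc lc c) letter_wt (T c).

Lemma is_tableau_empty lc b T : (forall k, (k < n)%N -> lc k = mc k) ->
  is_tableau K mc a lc b T <-> T = [ffun=> (0, false)].
Proof.
move=> empty; have out (c : 'I_L * 'I_n) : in_columns mc lc c = false.
  by rewrite /in_columns (@empty c.2 (ltn_ord _)) leqNgt andNb.
split=> [[outT _ _ _]|->]; first by apply/ffunP => c; rewrite ffunE outT ?out.
by split=> [c _|c c'|c c'|c]; rewrite ?ffunE ?out.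
Qed.

Lemma infeasible_no_tableau lc b T (k : 'I_n) : (lc k <= L)%N ->
  (mc k < lc k)%N -> lag b lc k + 1 < lag a mc k -> ~ is_tableau K mc a lc b T.
Proof.
move=> lcL ltk infeasible tabT.
have ltt : (mc k < L)%N by lia.
have ltb : ((lc k).-1 < L)%N by lia.
have top : in_columns mc lc (Ordinal ltt, k) by rewrite /in_columns /=; lia.
have bot : in_columns mc lc (Ordinal ltb, k) by rewrite /in_columns /=; lia.
have := column_growth tabT (k := (lc k).-1 - mc k) top bot erefl.
case: tabT => _ _ _ flagT; have := flagT _ top; have := flagT _ bot.
by rewrite /lag in infeasible; rewrite /=; lia.
Qed.

Lemma tableau_wt_upd lc (c0 : 'I_L * 'I_n) x T : c0.1.+1 = lc c0.2 -> (mc c0.2 < lc c0.2)%N ->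
  tableau_wt lc (upd c0 x T) = letter_wt x * tableau_wt (dec_at c0.2 lc) T.
Proof.
move=> c0row c0in; rewrite /tableau_wt (bigD1 c0) ?in_columns_corner //= /upd ffunE eqxx.
congr (_ * _); apply: eq_big => [c|c /andP[_ /negbTE nc]].
  by rewrite in_columns_dec.
by rewrite ffunE nc.
Qed.

(** The number of integers allowed in column [k]. Its total is the induction measure: both branches
    of the recursion lower a flag, but only one removes a cell. *)
Definition room b (k : nat) : nat := `|Num.max 0 (b k - a k + 1)|.

Lemma room_dec_flag b (i : 'I_n) : a i <= b i ->
  (\sum_(k < n) room (dec_flag i b) k < \sum_(k < n) room b k)%N.
Proof.
move=> leab; rewrite (bigD1 i) // [X in (_ < X)%N](bigD1 i) //= -addSn leq_add //.
  by rewrite /room /dec_flag eqxx; lia.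
by apply: leq_sum => k /negbTE ki; rewrite /room /dec_flag (ki : (k == i :> nat) = false).
Qed.

(** The type of fillings is infinite, so finiteness is part of the claim: a duplicate-free list is
    built along the recursion for the determinant. *)
Lemma tableaux_enum lc b : skew_columns n lc mc -> flags_ok n lc mc a b ->
  (forall j, (j < n)%N -> (lc j <= L)%N) ->
  exists s : seq (sfilling L n), [/\ uniq s,
    forall T, T \in s <-> is_tableau K mc a lc b T &
    \sum_(T <- s) tableau_wt lc T = \det (jt_matrix y z K n lc mc a b)].
Proof.
have [m] := ubnP (\sum_(k < n) room b k).
elim: m lc b => // m IHm lc b ltm shape flags lcL.
case: (boolP [exists k : 'I_n, (mc k < lc k)%N]) => [/existsP[k ltk]|]; last first.
  rewrite negb_exists => /forallP empty.
  have {}empty k : (k < n)%N -> lc k = mc k.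
    move=> ltk; have := empty (Ordinal ltk); case: shape => _ _ /(_ k ltk) /=; lia.
  exists [:: [ffun=> (0, false)]]; split=> //.
    by move=> T; rewrite inE (is_tableau_empty _ _ empty); split=> [/eqP|->].
  rewrite big_seq1 det_jt_empty // /tableau_wt big_pred0 // => c.
  by rewrite /in_columns (@empty c.2 (ltn_ord _)) leqNgt andNb.
have [|i lti [left right]] := exists_corner shape flags.
  by exists k.
case: (lerP (lag a mc i) (lag b lc i + 1)) => [feasible|infeasible]; last first.
  exists [::]; split=> // [T|]; last by rewrite big_nil (det_jt_infeasible _ _ _ shape flags (k := i)).
  by split=> // tabT; case: (infeasible_no_tableau (lcL _ (ltn_ord i)) lti infeasible tabT).
have leab : a i <= b i by rewrite /lag in feasible; lia.
have ltm' : (\sum_(k < n) room (dec_flag i b) k < m)%N.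
  by have := room_dec_flag leab; lia.
have c0L : ((lc i).-1 < L)%N by have := lcL i; have := ltn_ord i; lia.
pose c0 : 'I_L * 'I_n := (Ordinal c0L, i).
have c0row : c0.1.+1 = lc c0.2 by rewrite /=; lia.
have [s1 [uniq1 mem1 sum1]] := IHm _ _ ltm' shape (dec_flag_ok flags left) lcL.
rewrite (det_jt_rec _ _ _ shape flags lti) // -sum1.
have split_lt T : unprime K c0 (T c0) < b i ->
    (T \in s1 <-> is_tableau K mc a lc b T).
  move=> ltT; rewrite mem1; split=> [/(is_tableau_dec_flag (c0 := c0) c0row lti)[]//|tabT].
  exact: (unprime_bottom_lt (c0 := c0)).
have low T : T \in s1 -> unprime K c0 (T c0) < b i.
  by rewrite mem1 => /(is_tableau_dec_flag (c0 := c0) c0row lti)[].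
case: (boolP [&& (i.+1 < n)%N & lc i.+1 == lc i]) => [/andP[lti1 /eqP eqlc]|corner].
  exists s1; split=> //.
    move=> T; split=> [Ts1|tabT]; first by apply/split_lt => //; apply: low.
    apply/split_lt => //.
    exact: (blocked_corner_lt (c0 := c0) c0row lti shape right lti1 eqlc tabT).
  rewrite (det_jt_row_eq _ _ _ _ lti lti1 eqlc) ?mulr0 ?addr0 //.
  by apply: right; rewrite // eqlc.
have {}corner : (i.+1 < n)%N -> (lc i.+1 < lc i)%N.
  move=> lti1; move: corner; rewrite lti1 /=.
  by case: shape => lcD _ _; have := lcD i i.+1; lia.
have shape' := dec_skew_columns shape lti corner.
have flags' : flags_ok n (dec_at i lc) mc a (dec_flag i b).
  by apply: dec_flags_ok => //; lia.
have lcL' j : (j < n)%N -> (dec_at i lc j <= L)%N.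
  by move=> /lcL; rewrite /dec_at; case: eqP => _; lia.
have [s2 [uniq2 mem2 sum2]] := IHm _ _ ltm' shape' flags' lcL'.
(* The two letters that unprime to [b i] in the corner; the primed one is shifted by the content of
   [c0]. Their weights add up to the factor in [det_jt_rec]. *)
pose x1 : int * bool := (b i, false).
pose x2 : int * bool := (b i + (i%:Z - c0.1%:Z + K), true).
have val1 : unprime K c0 x1 = b i by [].
have val2 : unprime K c0 x2 = b i by rewrite /unprime /=; lia.
have s2_c0 T : T \in s2 -> T c0 = (0, false).
  rewrite mem2 => -[outT _ _ _]; apply: outT.
  by rewrite (in_columns_dec (c0 := c0)) ?eqxx ?andbF.
(* Tableaux in [s2] all carry the dummy value at [c0], so overwriting it loses nothing. *)
have upd_inj x : {in s2 &, injective (upd c0 x)}.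
  move=> T T' /s2_c0 T0 /s2_c0 T'0 /ffunP eqT; apply/ffunP => c.
  by have := eqT c; rewrite !ffunE; case: eqP => // ->; rewrite T0 T'0.
have upd_c0 x T : upd c0 x T c0 = x by rewrite ffunE eqxx.
(* The three lists are disjoint by their value at [c0]: below [b i], unprimed [b i], or primed. *)
exists (s1 ++ [seq upd c0 x1 T | T <- s2] ++ [seq upd c0 x2 T | T <- s2]); split.
- rewrite !cat_uniq uniq1 !map_inj_in_uniq ?uniq2 ?andbT //=; apply/andP; split.
    rewrite -all_predC all_cat !all_map; apply/andP; split; apply/allP => T _ /=;
      by apply/negP => /low; rewrite upd_c0 ?val1 ?val2 ltxx.
  rewrite -all_predC all_map; apply/allP => T _ /=; apply/negP => /mapP[T' _ /ffunP/(_ c0)].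
  by rewrite !upd_c0.
- move=> T; rewrite !mem_cat; split.
    case/or3P => [Ts1|/mapP[T' T's2 ->]|/mapP[T' T's2 ->]].
    + by apply/split_lt => //; apply: low.
    + by move/mem2: T's2 => tabT'; exact: (add_corner (c0 := c0) c0row lti shape lcL left corner feasible tabT' val1).
    + by move/mem2: T's2 => tabT'; exact: (add_corner (c0 := c0) c0row lti shape lcL left corner feasible tabT' val2).
  move=> tabT; case: (ltrP (unprime K c0 (T c0)) (b i)) => [ltT|leT].
    by apply/or3P/Or31/split_lt.
  have eqT : unprime K c0 (T c0) = b i.
    apply/le_anti; rewrite leT andbT; case: tabT => _ _ _ /(_ c0).
    by rewrite in_columns_corner //= => /(_ isT)/andP[].
  have T's2 : upd c0 (0, false) T \in s2.
    by apply/mem2; exact: (remove_corner (c0 := c0) c0row lti tabT eqT).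
  have eqU x : T c0 = x -> T = upd c0 x (upd c0 (0, false) T).
    by move=> <-; apply/ffunP => c; rewrite !ffunE; case: eqP => // ->.
  case: (T c0) (eqU (T c0) erefl) eqT => v [] eqTT eqv; apply/or3P.
    apply: Or33; apply/mapP; exists (upd c0 (0, false) T) => //.
    by rewrite {1}eqTT; congr (upd _ (_, _) _); rewrite -eqv /unprime /=; lia.
  apply: Or32; apply/mapP; exists (upd c0 (0, false) T) => //.
  by rewrite {1}eqTT; congr (upd _ (_, _) _); rewrite -eqv.
- rewrite !big_cat /= !big_map; congr (_ + _); rewrite -sum2 mulrBl !mulr_sumr -sumrB -big_split /=.
  apply: eq_bigr => T _; rewrite !tableau_wt_upd // /letter_wt /= mulNr.
  by congr (_ * _ - z _ * _); lia.
Qed.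
End Enumeration.

(** * Partitions and their conjugates *)

Section Partition.
Implicit Types l : seq nat.

(** In a weakly decreasing list the parts of size at least [j] form an initial segment, whose length
    is the count defining [conj]. *)
Lemma le_part_conj l (i j : nat) : is_partition l -> (0 < j)%N ->
  (j <= part l i.+1)%N = (i < conj l j)%N.
Proof.
rewrite /is_partition /part /conj /= => sorted_l j_gt0.
elim: l sorted_l i => [|p l IHl] sorted_l i /=; first by rewrite nth_nil; lia.
have {}IHl := IHl (path_sorted sorted_l).
case: (leqP j p) => [lejp|ltpj]; first by case: i => //= i; rewrite IHl.
have /allP le_p : all (geq p) l by apply: order_path_min sorted_l => x y t /=; lia.
have count0 : count (leq j) l = 0%N.
  apply/eqP; rewrite -leqn0 leqNgt -has_count; apply/hasPn => q /le_p /=.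
  by rewrite -ltnNge => ?; apply: leq_ltn_trans ltpj.
by rewrite count0; case: i => [|i] /=; rewrite ?IHl ?count0 // leqNgt ltpj.
Qed.

Lemma conj_antitone l (i j : nat) : (i <= j)%N -> (conj l j <= conj l i)%N.
Proof. by move=> leij; apply: sub_count => p /=; apply: leq_trans. Qed.

Lemma conj_subpart l mu (j : nat) : is_partition l -> is_partition mu -> subpart mu l ->
  (0 < j)%N -> (conj mu j <= conj l j)%N.
Proof.
move=> part_l part_mu sub j_gt0; case: (posnP (conj mu j)) => [-> //|mu_gt0].
have := le_part_conj (conj mu j).-1 part_mu j_gt0.
have := le_part_conj (conj mu j).-1 part_l j_gt0.
rewrite prednK // leqnn => <- le_mu; apply: leq_trans (sub _).
by rewrite le_mu.
Qed.

Lemma in_skew_conj l mu (i j : nat) : is_partition l -> is_partition mu ->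
  in_skew l mu i.+1 j.+1 = (conj mu j.+1 <= i < conj l j.+1)%N.
Proof.
by move=> part_l part_mu; rewrite /in_skew /= ltnNge !le_part_conj // -leqNgt.
Qed.
End Partition.

(** * Passage from r-shapes to columns numbered from 0 *)

Theorem theorem4p5 (R : comNzRingType) (lam mu : seq nat) (r : int) (n : nat)
    (a b : nat -> int) (y z : int -> R) :
  is_partition lam -> is_partition mu -> subpart mu lam ->
  column_flags lam mu n a b ->
  flagged_S lam mu r n a b y z =
  \sum_(T \in super_tableaux lam mu r n a b) wt lam mu y z T.
Proof.
move=> part_lam part_mu sub [_ flags].
pose K := r - 1 + (conj lam 1)%:Z.
pose lc j := conj lam j.+1; pose mc j := conj mu j.+1.
pose a0 j := a j.+1; pose b0 j := b j.+1.
have shape : skew_columns n lc mc.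
  split=> [i j|i j|j] ltj; first by apply: conj_antitone; lia.
    by apply: conj_antitone; lia.
  exact: conj_subpart.
have flags0 : flags_ok n lc mc a0 b0.
  move=> i ltin coupled; have [] := flags i.+1 isT ltin coupled.
  by rewrite /lag /lc /mc /a0 /b0; lia.
have lcL j : (j < n)%N -> (lc j <= size lam)%N by move=> _; apply: count_size.
have cinE (c : 'I_(size lam) * 'I_n) : cin lam mu c = in_columns mc lc c.
  exact: in_skew_conj.
have untildeE (T : sfilling (size lam) n) c : untilde lam r T c = unprime K c (T c).
  by rewrite /untilde /unprime /content /K; case: (T c).2 => //; lia.
have [s [uniq_s mem_s sum_s]] := tableaux_enum y z K shape flags0 lcL.
have -> : flagged_S lam mu r n a b y z = \det (jt_matrix y z K n lc mc a0 b0).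
  congr (\det _); apply/matrixP => i j; rewrite !mxE /entry.
  by congr (esuper _ (yseg _ _ _) (yseg _ _ _)); rewrite /conj_flag_a /conj_flag_b /content /lc /mc /K /a0 /b0; lia.
have -> : super_tableaux lam mu r n a b = [set` s]%classic.
  apply/seteqP; split=> T /=.
    case=> outT [rowT [colT flagT]]; apply/mem_s.
    split=> [c|c c'|c c'|c]; rewrite -?cinE -?untildeE; [exact: outT|exact: rowT|exact: colT|exact: flagT].
  move/mem_s=> [outT rowT colT flagT].
  split=> [c|]; first by rewrite cinE; apply: outT.
  split=> [c c'|]; first by rewrite !cinE !untildeE; apply: rowT.
  split=> [c c'|c]; first by rewrite !cinE !untildeE; apply: colT.
  by rewrite cinE untildeE; apply: flagT.
(* Since [s] has no duplicates, the sum over the set is the sum over the list. *)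
rewrite -fsbig_seq // -sum_s; apply: eq_bigr => T _.
by apply: eq_big => c; rewrite ?cinE.
Qed.
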